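(* Let $\mathfrak S=(\mathcal S,\mathcal U,T_{\mathfrak s})$ be a controlled Markov process, let $\mathcal P=\langle B_1,\dots,B_\ell\rangle$ be a partition of $\mathcal S$ into measurable sets, and let $\rho$ be any stationary control policy. Let $W:=\mathsf{WinDom}(\mathfrak S,\rho)=\{s\in\mathcal S\mid P_s^{\rho}(\mathfrak S\models \mathit{Parity}(\mathcal P))=1\}$. Then for every $s\in\mathcal S$: $P_s^{\rho}(\mathfrak S\models \mathit{Parity}(\mathcal P))=1$ if $s\in W$, and $P_s^{\rho}(\mathfrak S\models \mathit{Parity}(\mathcal P))\ge P_s^{\rho}(\mathfrak S\models \lozenge W)$ if $s\notin W$.
   Context: A controlled Markov process (CMP) is a tuple $\mathfrak S=(\mathcal S,\mathcal U,T_{\mathfrak s})$ where $\mathcal S$ is a Borel space (with its Borel $\sigma$-algebra $\mathcal B(\mathcal S)$), $\mathcal U$ is a finite set of inputs, and $T_{\mathfrak s}$ is a stochastic kernel assigning to each $s\in\mathcal S$, $u\in\mathcal U$ a probability measure $T_{\mathfrak s}(\cdot\mid s,u)$ on $(\mathcal S,\mathcal B(\mathcal S))$. A stationary control policy is a universally measurable map $\rho:\mathcal S\to\mathcal U$. For $s\in\mathcal S$, $P_s^\rho$ denotes the unique probability measure on infinite paths $(s^0,s^1,\dots)\in\mathcal S^\omega$ with $s^0=s$ and $s^{k+1}$ distributed according to $T_{\mathfrak s}(\cdot\mid s^k,\rho(s^k))$. Given the partition $\mathcal P=\langle B_1,\dots,B_\ell\rangle$ of $\mathcal S$ (some $B_i$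 may be empty; $i$ is the priority of $B_i$), an infinite path satisfies $\mathit{Parity}(\mathcal P)$ iff for every odd $i\in\{1,\dots,\ell\}$, if the path visits $B_i$ infinitely often then it visits $B_j$ infinitely often for some even $j\in\{i+1,\dots,\ell\}$; $(\mathfrak S\models\mathit{Parity}(\mathcal P))$ denotes the set of such paths. For $W\subseteq\mathcal S$, $(\mathfrak S\models\lozenge W)$ is the set of paths $(s^0,s^1,\dots)$ with $s^n\in W$ for some $n\in\mathbb N$. *)

(* Defs.v *)
From HB Require Import structures.
From mathcomp Require Import all_boot all_order all_algebra.
From mathcomp Require Import all_classical all_reals all_analysis measurable_realfun.

Set Implicit Arguments.
Unset Strict Implicit.
Unset Printing Implicit Defensive.

Import Order.TTheory GRing.Theory Num.Theory.
Local Open Scope classical_set_scope.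
Local Open Scope ring_scope.

Definition cmp_path (S : Type) := nat -> S.

Definition coord_gen (d : measure_display) (S : measurableType d)
  : set (set (nat -> S)) :=
  [set X | exists (n : nat) (A : set S),
     measurable A /\ X = (fun w : nat -> S => w n) @^-1` A].

Definition path_space (d : measure_display) (S : measurableType d) :=
  g_sigma_algebraType (@coord_gen _ S).

Definition stoch_kernel (d : measure_display) (S : measurableType d)
  (U : Type) (R : realType) (T : S -> U -> probability S R) : Prop :=
  forall (u : U) (A : set S), measurable A ->
    measurable_fun [set: S] (fun s : S => T s u A).

(* Universally measurable stationary policy rho : S -> U (U finite):
   every fibre rho^-1(u) is measurable w.r.t. the completion of every
   probability measure on S. *)
Definition universally_measurable_policy (d : measure_display)
  (S : measurableType d) (U : Type) (R : realType) (rho : S -> U) : Prop :=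
  forall (mu : probability S R) (u : U),
    exists A B : set S, [/\ measurable A, measurable B,
      A `<=` rho @^-1` [set u], rho @^-1` [set u] `<=` B &
      mu (B `\` A) = 0%E].

Fixpoint cylinder (S : Type) (As : seq (set S)) : set (nat -> S) :=
  match As with
  | [::] => [set: nat -> S]
  | A :: As' => [set w | A (w 0%N) /\ cylinder As' (fun n => w n.+1)]
  end.

(* P : S -> probability on paths is the family (P_s^rho)_s of path
   measures of the CMP under rho: it is characterized (uniquely) by its
   values on cylinders, given by the Markov recursion
     P_s(w0 in A, (w1,...) in C) = 1_A(s) * \int P_{s'}(C) T(ds'|s,rho s). *)
Definition is_path_measure (d : measure_display) (S : measurableType d)
  (U : Type) (R : realType) (T : S -> U -> probability S R) (rho : S -> U)
  (P : S -> probability (path_space S) R) : Prop :=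
  forall (A : set S) (As : seq (set S)),
    measurable A -> (forall B, B \in As -> measurable B) ->
    forall s : S,
      P s (cylinder (A :: As)) =
      ((\1_A s : R)%:E * \int[T s (rho s)]_(s' in [set: S]) P s' (cylinder As))%E.

(* Probability of an event E under a measure on paths, as the value of the
   completed measure: the inner measure (which coincides with mu E when E is
   measurable, and with the completion when E is mu-measurable). *)
Definition pr (d : measure_display) (T : measurableType d) (R : realType)
  (mu : probability T R) (E : set T) : \bar R :=
  ereal_sup [set mu A | A in [set A : set T | measurable A /\ A `<=` E]].

Definition inf_often (S : Type) (w : nat -> S) (X : set S) : Prop :=
  forall n : nat, exists m : nat, (n <= m)%N /\ X (w m).

Definition parity_event (S : Type) (l : nat) (B : nat -> set S)
  : set (nat -> S) :=
  [set w | forall i : nat, odd i -> (1 <= i <= l)%N -> inf_often w (B i) ->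
      exists j : nat, ~~ odd j /\ (i < j <= l)%N /\ inf_often w (B j)].

Definition reach_event (S : Type) (W : set S) : set (nat -> S) :=
  [set w | exists n : nat, W (w n)].

Definition measurable_partition (d : measure_display) (S : measurableType d)
  (l : nat) (B : nat -> set S) : Prop :=
  [/\ forall i, (1 <= i <= l)%N -> measurable (B i),
      forall s : S, exists i, (1 <= i <= l)%N /\ B i s &
      forall i j, (1 <= i <= l)%N -> (1 <= j <= l)%N -> i <> j ->
        B i `&` B j = set0].

Definition WinDom (d : measure_display) (S : measurableType d) (R : realType)
  (P : S -> probability (path_space S) R) (l : nat) (B : nat -> set S)
  : set S :=
  [set s | pr (P s) (parity_event l B) = 1%E].

(* Main.v *)
(* Parity is invariant under deleting the first state, so by the Markov
   property P_s(w_n in D, not Parity) is the integral over D of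
   P_x(not Parity) against the law of w_n, which vanishes for measurable
   D contained in W. The difficulty is that W is only universally measurable,
   since the policy is: for every s and n we sandwich W between two measurable
   sets that differ by a null set for the law of w_n under P_s, and conclude
   that almost no path visits W without satisfying the parity condition. *)
Require Import Defs.
From HB Require Import structures.
From mathcomp Require Import all_boot all_order all_algebra.
From mathcomp Require Import all_classical all_reals all_analysis measurable_realfun.
From mathcomp Require Import giry.

Set Implicit Arguments.
Unset Strict Implicit.
Unset Printing Implicit Defensive.

Import Order.TTheory GRing.Theory Num.Theory.
Import HBNNSimple.
Local Open Scope classical_set_scope.
Local Open Scope ring_scope.
Local Open Scope ereal_scope.

(** * Integration of functions that are measurable up to a null set *)

Definition ae_measurable d (S : measurableType d) (R : realType)
    (mu : {measure set S -> \bar R}) (g : S -> \bar R) :=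
  exists2 h : S -> \bar R,
    measurable_fun [set: S] h & \forall x \ae mu, g x = h x.

(** Measurability for the completion of every probability measure, phrased through a Borel version
    that may change with [mu]. *)
Definition univ_measurable d (S : measurableType d) (R : realType)
    (g : S -> \bar R) :=
  forall mu : probability S R, ae_measurable mu g.

Lemma ae_measurable_ge0 d (S : measurableType d) (R : realType)
    (mu : {measure set S -> \bar R}) (g : S -> \bar R) :
  (forall x, 0 <= g x) -> ae_measurable mu g ->
  exists h : S -> \bar R, [/\ measurable_fun [set: S] h,
    forall x, 0 <= h x & \forall x \ae mu, g x = h x].
Proof.
move=> g0 [h mh gh]; exists (abse \o h); split.
- exact: measurableT_comp.
- by move=> x; exact: abse_ge0.
- by apply: filterS gh => x /= <-; rewrite gee0_abs.
Qed.

(* [g] need not be measurable: [\int[mu]_x g x] is then the supremum over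
   the simple functions below [g]. *)
Lemma ge0_integral_ae d (S : measurableType d) (R : realType)
    (mu : {measure set S -> \bar R}) (g h : S -> \bar R) :
  (forall x, 0 <= g x) -> (forall x, 0 <= h x) ->
  measurable_fun [set: S] h -> (\forall x \ae mu, g x = h x) ->
  \int[mu]_x g x = \int[mu]_x h x.
Proof.
move=> g0 h0 mh gh; apply/eqP; rewrite eq_le; apply/andP; split.
  (* A simple function below [g] lies almost everywhere below [h]. *)
  rewrite [leLHS]ge0_integralTE//; apply: ge_ereal_sup => _ [G Gg <-].
  rewrite -integralT_nnsfun; apply: ae_ge0_le_integral => //.
  - by move=> x _; rewrite lee_fin; exact: fun_ge0.
  - by apply/measurable_EFinP; exact: measurable_funPT.
  - by apply: filterS gh => x <- _; exact: Gg.
case: gh => N [mN N0 gh].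
(* Cutting [h] to zero on the null set [N] keeps its integral and puts it below [g] everywhere, so
   simple functions below the cut [h] are admissible for [g]. *)
have mhN : measurable_fun [set: S] (h \_ (~` N)).
  apply/(measurable_restrictT _ _).1; first exact: measurableC.
  exact: measurable_funTS.
have hN0 x : 0 <= (h \_ (~` N)) x by rewrite patchE; case: ifPn.
have -> : \int[mu]_x h x = \int[mu]_x (h \_ (~` N)) x.
  apply: ge0_ae_eq_integral => //.
  exists N; split => // x /=; apply: contra_notP => Nx _.
  by rewrite patchE mem_set.
rewrite [leLHS]ge0_integralTE// [leRHS]ge0_integralTE//.
apply: le_ereal_sup => _ [G /= Gh <-]; exists G => //= x.
apply: (le_trans (Gh x)); rewrite patchE; case: ifPn => // /set_mem Nx.
by have -> : g x = h x by apply: contrapT => /gh.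
Qed.

(** A supremum over simple functions is in general only superadditive; passing to measurable
    versions of [f] and [g] restores equality. *)
Lemma integralD_ae d (S : measurableType d) (R : realType)
    (mu : {measure set S -> \bar R}) (f g : S -> \bar R) :
  (forall x, 0 <= f x) -> (forall x, 0 <= g x) ->
  ae_measurable mu f -> ae_measurable mu g ->
  \int[mu]_x (f x + g x) = \int[mu]_x f x + \int[mu]_x g x.
Proof.
move=> f0 g0 /(ae_measurable_ge0 f0)[f' [mf f'0 ff]].
move=> /(ae_measurable_ge0 g0)[g' [mg g'0 gg]].
rewrite (ge0_integral_ae f0 f'0)// (ge0_integral_ae g0 g'0)//.
rewrite -ge0_integralD//; apply: ge0_integral_ae.
- by move=> x; exact: adde_ge0.
- by move=> x; exact: adde_ge0.
- exact: emeasurable_funD.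
- by apply: filterS2 ff gg => x -> ->.
Qed.

Lemma integral_nneseries_ae d (S : measurableType d) (R : realType)
    (mu : {measure set S -> \bar R}) (f : (S -> \bar R)^nat) :
  (forall n x, 0 <= f n x) -> (forall n, ae_measurable mu (f n)) ->
  \int[mu]_x (\sum_(n <oo) f n x) = \sum_(n <oo) \int[mu]_x f n x.
Proof.
move=> f0 mf.
have /choice[h hP] n := ae_measurable_ge0 (f0 n) (mf n).
have mh n : measurable_fun [set: S] (h n) by have [] := hP n.
have h0 n x : 0 <= h n x by have [] := hP n.
have fh n : \forall x \ae mu, f n x = h n x by have [] := hP n.
transitivity (\sum_(n <oo) \int[mu]_x h n x); last first.
  by apply: eq_eseriesr => n _; rewrite (ge0_integral_ae (f0 n) (h0 n)).
rewrite -integral_nneseries//; apply: ge0_integral_ae.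
- by move=> x; exact: nneseries_ge0.
- by move=> x; exact: nneseries_ge0.
- by apply: ge0_emeasurable_sum.
- apply: filterS (ae_foralln fh) => x fhx.
  by apply: eq_eseriesr => n _.
Qed.

(** * Mixtures of a stochastic kernel *)

Section mixture.
Context d d' (S : measurableType d) (S' : measurableType d') (R : realType).

(** The law of a point drawn from [k s] after [s] is drawn from [mu]. The proof [mk] is an argument
    so that the probability structure can be attached to the term. *)
Definition mixture (mu : probability S R) (k : S -> probability S' R)
    (mk : forall A, measurable A -> measurable_fun [set: S] (k ^~ A))
    (A : set S') := \int[mu]_s k s A.

Context (mu : probability S R) (k : S -> probability S' R)
  (mk : forall A, measurable A -> measurable_fun [set: S] (k ^~ A)).

Let mixture0 : mixture mu mk set0 = 0.
Proof. by rewrite /mixture; apply: integral0_eq => s _; rewrite measure0. Qed.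

Let mixture_ge0 A : 0 <= mixture mu mk A.
Proof. by apply: integral_ge0. Qed.

Let mixture_sigma_additive : semi_sigma_additive (mixture mu mk).
Proof.
move=> F mF tF mUF; rewrite [X in _ --> X](_ : _ =
  \int[mu]_s (\sum_(n <oo) k s (F n))); last first.
  apply: eq_integral => s _.
  by apply/esym/cvg_lim => //; exact/measure_semi_sigma_additive.
apply/cvg_closeP; split.
  by apply: is_cvg_nneseries => n _ _; exact: integral_ge0.
by rewrite closeE// integral_nneseries// => n; exact: mk.
Qed.

HB.instance Definition _ := isMeasure.Build _ _ R (mixture mu mk)
  mixture0 mixture_ge0 mixture_sigma_additive.

Let mixture_setT : mixture mu mk [set: S'] = 1.
Proof.
rewrite /mixture (eq_integral (cst 1)).
  by rewrite integral_cst// mul1e; exact: probability_setT.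
by move=> s _; rewrite probability_setT.
Qed.

HB.instance Definition _ :=
  Measure_isProbability.Build _ _ _ (mixture mu mk) mixture_setT.

(** The mass [k s N] of a null set [N] of the mixture is nonnegative with integral zero, hence zero
    for almost every [s]. *)
Lemma ae_mixture (Q : S' -> Prop) :
  (\forall x \ae mixture mu mk, Q x) ->
  \forall s \ae mu, \forall x \ae k s, Q x.
Proof.
move=> [N [mN N0 QN]].
have : \forall s \ae mu, [set: S] s -> k s N = 0.
  apply/(ae_eq_integral_abs mu measurableT (mk mN)).
  by rewrite -[RHS]N0; apply: eq_integral => s _; rewrite gee0_abs.
by apply: filterS => s /(_ Logic.I) ksN; exists N.
Qed.

(** The kernel is a measurable map into the Giry space of measures, where integrating a fixed [h] is
    measurable. *)
Lemma measurable_integral_kernel (h : S' -> \bar R) :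
  measurable_fun [set: S'] h -> (forall x, 0 <= h x) ->
  measurable_fun [set: S] (fun s => \int[k s]_x h x).
Proof.
move=> mh h0.
have mg := measurable_giry_int (R := R) mh h0.
pose k' s : giry S' R := k s.
have mk' : measurable_fun [set: S] k' by exact: measurable_giry_codensity.
exact: (measurableT_comp mg mk').
Qed.

End mixture.

(** * Path space: coordinates, shift and cylinders *)

Definition path_tail (S : Type) (w : nat -> S) : nat -> S := fun n => w n.+1.

Definition cylinders d (S : measurableType d) : set (set (nat -> S)) :=
  [set X | exists As : seq (set S),
    (forall B, B \in As -> measurable B) /\ X = cylinder As].

Definition path_at d (S : measurableType d) (n : nat) : path_space S -> S :=
  fun w => w n.

Lemma measurable_path_at d (S : measurableType d) (n : nat) :
  measurable_fun [set: path_space S] (@path_at _ S n).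
Proof.
move=> _ A mA; rewrite setTI.
by apply: sub_sigma_algebra; exists n, A.
Qed.

HB.instance Definition _ d (S : measurableType d) (n : nat) :=
  @isMeasurableFun.Build _ _ _ _ (@path_at _ S n) (@measurable_path_at _ S n).

Lemma measurable_path_tail d (S : measurableType d) :
  measurable_fun [set: path_space S] (@path_tail S : path_space S -> path_space S).
Proof.
apply: (@measurability _ _ _ (path_space S) setT _ (@coord_gen _ S)) => // _ [_ [n [A [mA ->]]] <-].
exact: (measurable_path_at n.+1).
Qed.

Lemma measurable_cylinder d (S : measurableType d) (As : seq (set S)) :
  (forall B, B \in As -> measurable B) ->
  measurable (cylinder As : set (path_space S)).
Proof.
elim: As => [_|A As IH mAs]; first exact: measurableT.
have -> : cylinder (A :: As) =
    (@path_at _ S 0 @^-1` A) `&` (@path_tail S @^-1` cylinder As).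
  by [].
apply: measurableI; rewrite -[X in measurable X]setTI.
  by apply: measurable_path_at => //; apply: mAs; rewrite mem_head.
apply: measurable_path_tail => //; apply: IH => B BAs.
by apply: mAs; rewrite in_cons BAs orbT.
Qed.

Lemma cylinders_setI d (S : measurableType d) : setI_closed (@cylinders _ S).
Proof.
move=> _ _ [As [mAs ->]] [Bs [mBs ->]].
elim: As Bs mAs mBs => [|A As IH] [|B Bs] mAs mBs /=.
- by exists [::]; split => //; rewrite setTI.
- by exists (B :: Bs); split => //; rewrite setTI.
- by exists (A :: As); split => //; rewrite setIT.
have [X XAs|X XBs|Cs [mCs CsE]] := IH Bs.
- by apply: mAs; rewrite in_cons XAs orbT.
- by apply: mBs; rewrite in_cons XBs orbT.
exists (A `&` B :: Cs); split.
  move=> X; rewrite in_cons => /predU1P[->|]; last exact: mCs.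
  by apply: measurableI; [apply: mAs|apply: mBs]; rewrite mem_head.
have Cs_iff w : cylinder Cs w <-> (cylinder As `&` cylinder Bs) w by rewrite CsE.
apply/seteqP; split => w /=.
  by move=> [[Aw Asw] [Bw Bsw]]; split => //; apply/Cs_iff.
by move=> [[Aw Bw] /Cs_iff[]].
Qed.

Lemma measurable_cylinders d (S : measurableType d) :
  @measurable _ (path_space S) = <<s @cylinders _ S >>.
Proof.
apply/seteqP; split; last first.
  apply: smallest_sub; first exact: sigma_algebra_measurable.
  by move=> _ [As [mAs ->]]; exact: measurable_cylinder.
apply: smallest_sub; first exact: smallest_sigma_algebra.
move=> _ [n [A [mA ->]]]; apply: sub_sigma_algebra.
(* A condition on coordinate [n] alone is a cylinder whose first [n] factors are the whole space. *)
exists (rcons (nseq n setT) A); split.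
  move=> B; rewrite mem_rcons in_cons => /predU1P[->//|].
  by rewrite mem_nseq => /andP[_ /eqP ->].
elim: n => [|n IH] /=; first by apply/seteqP; split => w //= [].
have IHw (w : nat -> S) : A (w n) <-> cylinder (rcons (nseq n setT) A) w.
  by rewrite -IH.
by apply/seteqP; split => w /=; [move=> /(IHw (path_tail w))|case=> _ /IHw].
Qed.

(** Dynkin's pi-lambda principle: cylinders are closed under intersection and generate the
    sigma-algebra. *)
Lemma cylinder_ind d (S : measurableType d) (Q : set (path_space S) -> Prop) :
  (forall As : seq (set S), (forall B, B \in As -> measurable B) ->
    Q (cylinder As)) ->
  (forall F, measurable F -> Q F -> Q (~` F)) ->
  (forall F : (set (path_space S))^nat, (forall n, measurable (F n)) ->
    trivIset [set: nat] F -> (forall n, Q (F n)) -> Q (\bigcup_n F n)) ->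
  forall F, measurable F -> Q F.
Proof.
move=> Qcyl QC Qbigcup F; rewrite [X in X F -> _]measurable_cylinders.
apply: (dynkin_induction (measurable_cylinders S)) => //.
- exact: cylinders_setI.
- exact: (Qcyl [::]).
- by move=> _ [As [mAs ->]]; exact: Qcyl.
Qed.

(** * Shift invariance and measurability of the parity event *)

Lemma inf_often_tail (S : Type) (w : nat -> S) (X : set S) :
  inf_often (path_tail w) X <-> inf_often w X.
Proof.
split=> wX n.
  by have [m [nm Xm]] := wX n; exists m.+1; split => //; exact: leqW.
by have [[|m] [//= nm Xm]] := wX n.+1; exists m.
Qed.

Lemma parity_event_tail (S : Type) (l : nat) (B : nat -> set S) :
  @path_tail S @^-1` parity_event l B = parity_event l B.
Proof.
apply/seteqP; split => w /= wB i oi il wi.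
  have [j [oj [ij wj]]] := wB i oi il ((inf_often_tail w (B i)).2 wi).
  by exists j; do 2!split => //; exact: (inf_often_tail w (B j)).1.
have [j [oj [ij wj]]] := wB i oi il ((inf_often_tail w (B i)).1 wi).
by exists j; do 2!split => //; exact: (inf_often_tail w (B j)).2.
Qed.

Lemma measurable_inf_often d (S : measurableType d) (X : set S) :
  measurable X -> measurable ([set w | inf_often w X] : set (path_space S)).
Proof.
move=> mX; rewrite (_ : [set w | _] =
  \bigcap_n \bigcup_(m in [set m | (n <= m)%N])
    @path_at _ S m @^-1` X); last first.
  apply/seteqP; split => [w wX n _|w wX n].
    by have [m [nm Xm]] := wX n; exists m.
  by have [m nm Xm] := wX n Logic.I; exists m.
apply: bigcapT_measurable => n; apply: bigcup_measurable => m _.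
by rewrite -[X in measurable X]setTI; exact: measurable_path_at.
Qed.

Lemma measurable_parity_event d (S : measurableType d) (l : nat)
    (B : nat -> set S) :
  (forall i, (1 <= i <= l)%N -> measurable (B i)) ->
  measurable (parity_event l B : set (path_space S)).
Proof.
move=> mB; rewrite (_ : parity_event l B =
  \bigcap_(i in [set i | odd i /\ (1 <= i <= l)%N])
   (~` [set w | inf_often w (B i)] `|`
    \bigcup_(j in [set j | ~~ odd j /\ (i < j <= l)%N])
      [set w | inf_often w (B j)])); last first.
  apply/seteqP; split => [w wB i [oi il]|w wB i oi il wi].
    have [/(wB i oi il)[j [oj [ij wj]]]|] := pselect (inf_often w (B i)).
      by right; exists j.
    by left.
  by have [//|[j [oj ij] wj]] := wB i (conj oi il); exists j.
apply: bigcap_measurableType => i [oi il]; apply: measurableU.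
  by apply: measurableC; apply: measurable_inf_often; exact: mB.
apply: bigcup_measurable => j [oj /andP[ij jl]].
apply: measurable_inf_often; apply: mB.
by rewrite jl (leq_ltn_trans _ ij).
Qed.

(** * Universal measurability of path probabilities *)

Lemma ae_policy d (S : measurableType d) (U : Type) (R : realType)
    (rho : S -> U) (mu : probability S R) (u : U) :
  universally_measurable_policy R rho ->
  exists A : set S, measurable A /\ \forall s \ae mu, A s <-> rho s = u.
Proof.
move=> /(_ mu u)[A [B [mA mB Arho rhoB BA0]]]; exists A; split => //.
exists (B `\` A); split => //; first exact: measurableD.
move=> s /= sA; split; first by apply: contrapT => Bs; apply: sA; split;
  [exact: Arho|move=> /rhoB].
by move=> As; apply: sA; split => // _; exact: Arho.
Qed.

Lemma univ_measurable_policy_integral d (S : measurableType d) (U : finType)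
    (R : realType) (T : S -> U -> probability S R) (rho : S -> U)
    (g : S -> \bar R) :
  stoch_kernel T -> universally_measurable_policy R rho ->
  (forall s, 0 <= g s) -> univ_measurable g ->
  univ_measurable (fun s => \int[T s (rho s)]_s' g s').
Proof.
move=> mT mrho g0 mg mu.
have mTu u A : measurable A -> measurable_fun [set: S] (fun s => T s u A).
  exact: mT.
(* Versions of [g] are taken for the mixture of [T s u] over [mu], so that for [mu]-almost every [s]
   they are versions for [T s u] itself. *)
have /choice[h hP] u := ae_measurable_ge0 g0 (mg (mixture mu (mTu u))).
have /choice[A AP] u := ae_policy mu u mrho.
(* For almost every [s] only the term [u = rho s] survives, because [A u] agrees almost everywhere
   with the fibre of [rho] over [u]. *)
exists (fun s => \sum_(u : U) (\1_(A u) s : R)%:E * \int[T s u]_s' h u s').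
  apply: emeasurable_sum => u _; have [mh h0 _] := hP u.
  apply: emeasurable_funM => //; last first.
    exact: (measurable_integral_kernel (k := fun s => T s u) (mTu u) mh h0).
  by apply/measurable_EFinP; apply: measurable_indic; exact: (AP u).1.
have Tgh : \forall s \ae mu, forall u,
    (* Finiteness of [U] merges the exceptional null sets of the inputs into one. *)
    \int[T s u]_s' g s' = \int[T s u]_s' h u s'.
  apply: filter_forall => u; have [mh h0 gh] := hP u.
  by apply: filterS (ae_mixture gh) => s; exact: ge0_integral_ae.
have rhoA : \forall s \ae mu, forall u, A u s <-> rho s = u.
  by apply: filter_forall => u; exact: (AP u).2.
apply: filterS2 Tgh rhoA => s Tgh rhoA.
rewrite (bigD1 (rho s))//= big1 ?adde0 => [|u urho].
  by rewrite indicE mem_set ?mul1e//; exact/rhoA.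
rewrite indicE memNset ?mul0e// => /rhoA rhou.
by rewrite rhou eqxx in urho.
Qed.

(** On cylinders the Markov recursion reduces this to integration under the policy; complements and
    disjoint unions keep it. *)
Lemma univ_measurable_path_measure d (S : measurableType d) (U : finType)
    (R : realType) (T : S -> U -> probability S R) (rho : S -> U)
    (P : S -> probability (path_space S) R) (F : set (path_space S)) :
  stoch_kernel T -> universally_measurable_policy R rho ->
  is_path_measure T rho P -> measurable F -> univ_measurable (fun s => P s F).
Proof.
move=> mT mrho PT; move: F; apply: cylinder_ind.
- elim=> [_ mu|A As IH mAs mu].
    exists (cst 1) => //; apply: aeW => s; exact: probability_setT.
  have mA : measurable A by apply: mAs; rewrite mem_head.
  have mAs' B : B \in As -> measurable B.
    by move=> BAs; apply: mAs; rewrite in_cons BAs orbT.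
  have [h mh gh] := univ_measurable_policy_integral mT mrho
    (fun s => measure_ge0 (P s) (cylinder As)) (IH mAs') mu.
  exists (fun s => (\1_A s : R)%:E * h s).
    apply: emeasurable_funM => //.
    by apply/measurable_EFinP; exact: measurable_indic.
  by apply: filterS gh => s <-; exact: PT.
- move=> F mF PF mu; have [h mh Ph] := PF mu.
  exists (fun s => 1 - h s); first exact: emeasurable_funB.
  by apply: filterS Ph => s <-; exact: probability_setC.
- move=> F mF tF PF mu.
  have /choice[h hP] n :=
    ae_measurable_ge0 (fun s => measure_ge0 (P s) (F n)) (PF n mu).
  exists (fun s => \sum_(n <oo) h n s).
    apply: ge0_emeasurable_sum => // n *; first by have [_ + _] := hP n; apply.
    by have [] := hP n.
  have /ae_foralln : forall n, \forall s \ae mu, P s (F n) = h n s.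
    by move=> n; have [] := hP n.
  apply: filterS => s Ph; rewrite measure_semi_bigcup//.
    by apply: eq_eseriesr => n _; exact: Ph.
  exact: bigcup_measurable.
Qed.

(** * The Markov property at time one *)

Lemma path_measure_tail d (S : measurableType d) (U : finType)
    (R : realType) (T : S -> U -> probability S R) (rho : S -> U)
    (P : S -> probability (path_space S) R) (F : set (path_space S)) (s : S) :
  stoch_kernel T -> universally_measurable_policy R rho ->
  is_path_measure T rho P -> measurable F ->
  P s (@path_tail S @^-1` F) = \int[T s (rho s)]_s' P s' F.
Proof.
move=> mT mrho PT.
have mP G mG := @univ_measurable_path_measure _ _ _ _ _ _ _ G mT mrho PT mG (T s (rho s)).
have mtail (G : set (path_space S)) : measurable G ->
    measurable (@path_tail S @^-1` G : set (path_space S)).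
  by move=> mG; rewrite -[X in measurable X]setTI; exact: measurable_path_tail.
move: F; apply: cylinder_ind.
- move=> As mAs; have := PT setT As measurableT mAs s.
  rewrite indicT mul1e => <-; congr (P s _).
  by apply/seteqP; split => w //= [].
- move=> F mF PF.
  (* The integrands have only measurable versions, so the complement is obtained from additivity:
     both integrals sum to 1, and the one of [F] is finite. *)
  have : \int[T s (rho s)]_s' (P s' F + P s' (~` F)) = 1.
    rewrite (eq_integral (cst 1)) ?integral_cst ?mul1e//.
      exact: probability_setT.
    move=> s' _; rewrite probability_setC// addeC subeK//.
    exact: fin_num_measure.
  rewrite integralD_ae//; [|exact: mP|by apply: mP; exact: measurableC].
  rewrite -PF preimage_setC (probability_setC _ (mtail _ mF)) => <-.
  by rewrite addeAC subee ?add0e//; exact: fin_num_measure (mtail _ mF).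
- move=> F mF tF PF; rewrite preimage_bigcup measure_semi_bigcup//.
  + transitivity (\int[T s (rho s)]_s' \sum_(n <oo) P s' (F n)).
      rewrite integral_nneseries_ae//; last by move=> n; exact: mP.
      by apply: eq_eseriesr => n _; exact: PF.
    apply: eq_integral => s' _; rewrite measure_semi_bigcup//.
    exact: bigcup_measurable.
  + by move=> n; exact: mtail.
  + by move=> i j _ _ [w [iw jw]]; apply: tF => //; exists (path_tail w).
  + by apply: bigcup_measurable => n _; exact: mtail.
Qed.

(** * Null events and the comparison with reachability *)

Lemma pr_measurable d (T : measurableType d) (R : realType)
    (mu : probability T R) (E : set T) : measurable E -> pr mu E = mu E.
Proof.
move=> mE; apply/eqP; rewrite eq_le; apply/andP; split.
  by apply: ge_ereal_sup => _ [A [mA AE] <-]; rewrite le_measure// inE.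
by apply: ereal_sup_ubound; exists E => //; split.
Qed.

(* The target [E] is the failure of the parity condition and [D] a measurable
   part of the winning domain. *)
Lemma null_winning_visit d (S : measurableType d) (U : finType)
    (R : realType) (T : S -> U -> probability S R) (rho : S -> U)
    (P : S -> probability (path_space S) R) (E : set (path_space S))
    (D : set S) (n : nat) (s : S) :
  stoch_kernel T -> universally_measurable_policy R rho ->
  is_path_measure T rho P -> measurable E -> @path_tail S @^-1` E = E ->
  measurable D -> (forall s', D s' -> P s' E = 0) ->
  P s (@path_at _ S n @^-1` D `&` E) = 0.
Proof.
move=> mT mrho PT mE tailE mD DE.
have mvisit k : measurable (@path_at _ S k @^-1` D).
  by rewrite -[X in measurable X]setTI; exact: measurable_path_at.
elim: n s => [|n IH] s.
  (* At time 0 the path sits at [s]: either [s] is in [D] and [E] is null, or the visit itself has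
     probability 0. *)
  have [Ds|nDs] := pselect (D s).
    apply/eqP; rewrite -measure_le0 -(DE _ Ds).
    by rewrite le_measure ?inE//; exact: measurableI.
  apply/eqP; rewrite -measure_le0.
  apply: (@le_trans _ _ (P s (cylinder [:: D]))).
    rewrite le_measure ?inE//; [exact: measurableI| |by move=> w []].
    by apply: measurable_cylinder => B; rewrite mem_seq1 => /eqP ->.
  have -> := PT D [::] mD (fun X X0 => False_ind _ (notF X0)) s.
  by rewrite indicE memNset// mul0e.
(* Invariance of [E] makes the event at time [n.+1] the shift preimage of the event at time [n],
   which is null from every successor state. *)
have -> : @path_at _ S n.+1 @^-1` D `&` E =
    @path_tail S @^-1` (@path_at _ S n @^-1` D `&` E).
  by rewrite preimage_setI tailE.
rewrite (path_measure_tail s mT mrho PT); last exact: measurableI.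
exact: integral0_eq.
Qed.

Local Close Scope ereal_scope.

Theorem theorem1 (R : realType) (d : measure_display) (S : measurableType d)
  (U : finType) (T : S -> U -> probability S R)
  (l : nat) (B : nat -> set S) (rho : S -> U)
  (P : S -> probability (path_space S) R) :
  stoch_kernel T ->
  measurable_partition l B ->
  universally_measurable_policy R rho ->
  is_path_measure T rho P ->
  let W := WinDom P l B in
  forall s : S,
    (W s -> pr (P s) (parity_event l B) = 1%E) /\
    (~ W s -> (pr (P s) (reach_event W) <= pr (P s) (parity_event l B))%E).
Proof.
move=> mT [mB _ _] mrho PT W s; split => // _.
pose E : set (path_space S) := parity_event l B.
have mE : measurable E by exact: measurable_parity_event.
have mCE : measurable (~` E) by exact: measurableC.
have tailCE : @path_tail S @^-1` (~` E) = ~` E.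
  have tailE : @path_tail S @^-1` E = E by exact: parity_event_tail.
  by rewrite -[in RHS]tailE.
(* [W] becomes the zero set of a universally measurable function. *)
have WE s' : W s' <-> P s' (~` E) = 0%E.
  rewrite /W /WinDom /= (pr_measurable _ mE) probability_setC//.
  split=> [->|]; first by rewrite subee.
  by move=> /eqP; rewrite sube_eq ?fin_num_measure// ?add0e => // /eqP.
have mvisit n D : measurable D -> measurable (@path_at _ S n @^-1` D).
  by move=> mD; rewrite -[X in measurable X]setTI; exact: measurable_path_at.
have visit_null n : exists D : set S,
    [/\ measurable D, W `<=` D & P s (@path_at _ S n @^-1` D `&` ~` E) = 0%E].
  (* [h] is a Borel version of the failure probability for the law of the [n]-th state under [P s];
     it is exact outside the null set [N]. *)
  have [h mh [N [mN N0 hN]]] :=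
    univ_measurable_path_measure mT mrho PT mCE (distribution (P s) (@path_at _ S n)).
  have mh0 : measurable (h @^-1` [set 0%E]).
    by rewrite -[X in measurable X]setTI; exact: mh.
  (* This [D] lies inside [W], while adding [N] covers [W]; the path is in [N] at time [n] with
     probability 0. *)
  pose D := h @^-1` [set 0%E] `\` N.
  have mD : measurable D by exact: measurableD.
  have DE s' : D s' -> P s' (~` E) = 0%E.
    by move=> [/= hs' Ns']; rewrite -hs'; apply: contrapT => /hN.
  exists (D `|` N); split; first exact: measurableU.
    move=> s' /WE Ps'; have [Ns'|Ns'] := pselect (N s'); first by right.
    by left; split => //=; rewrite -Ps'; apply/esym; apply: contrapT => /hN.
  rewrite preimage_setU setIUl; apply: null_set_setU.
  - by apply: measurableI => //; exact: mvisit.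
  - by apply: measurableI => //; exact: mvisit.
  - exact: (null_winning_visit n s mT mrho PT mCE tailCE mD DE).
  - apply/eqP; rewrite -measure_le0 -[leRHS]N0.
    by rewrite le_measure ?inE//; [apply: measurableI => //|]; exact: mvisit.
have /choice[D DP] := visit_null.
(* [pr] of the reachability event is a supremum over its measurable subsets [A]; each is covered by
   [E] and countably many null failure events, one per visit time. *)
rewrite (pr_measurable _ mE); apply: ge_ereal_sup => _ [A [mA AW] <-].
apply: (@le_trans _ _ (P s (E `|` \bigcup_n (@path_at _ S n @^-1` D n `&` ~` E)))).
  rewrite le_measure ?inE//.
    apply: measurableU => //; apply: bigcup_measurable => n _.
    by apply: measurableI => //; apply: mvisit; have [] := DP n.
  move=> w /AW[n Wn]; have [Ew|nEw] := pselect (E w); first by left.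
  by right; exists n => //; split => //; have [_ + _] := DP n; apply.
have mDE n : measurable (@path_at _ S n @^-1` D n `&` ~` E).
  by apply: measurableI => //; apply: mvisit; have [] := DP n.
rewrite measureU0//; first exact: bigcup_measurable.
apply/negligibleP; first exact: bigcup_measurable.
by apply: negligible_bigcup => n; apply/negligibleP => //; have [] := DP n.
Qed.
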